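(* Let $N,d\ge 1$ be integers, let $m=(N-1)d^2+Nd+1$, and let $f:\mathbb{R}^{m}\to\mathbb{R}$ be the deep linear network training objective $$f(W_1,\ldots,W_N,b_1,\ldots,b_N)=\tfrac12\left[\eta_{\mathbf{0}}+\log(1+\exp(-\eta_{\mathbf{0}}))\right]+\tfrac12\log(1+\exp(-\eta_{\mathbf{s}_1})),$$ where the parameters are $W_1,\ldots,W_{N-1}\in\mathbb{R}^{d\times d}$, $W_N\in\mathbb{R}^{1\times d}$, $b_1,\ldots,b_{N-1}\in\mathbb{R}^d$, $b_N\in\mathbb{R}$ (identified with a vector in $\mathbb{R}^{m}$), and, for $z\in\mathbb{R}^d$, $$\eta_z=W_N(W_{N-1}(\cdots(W_2(W_1z+b_1)+b_2)\cdots)+b_{N-1})+b_N.$$ Then $\nabla f:\mathbb{R}^m\to\mathbb{R}^m$ is locally Lipschitz continuous.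
   Context: $\mathbf{0}\in\mathbb{R}^d$ is the zero vector and $\mathbf{s}_1\in\mathbb{R}^d$ is the first standard basis vector. A continuous function $D:\mathbb{R}^m\to\mathbb{R}^m$ is locally Lipschitz continuous if for every $x\in\mathbb{R}^m$ there exist an open ball $B_x$ around $x$ and a constant $C_{B_x}\ge 0$ such that $\Vert D(x_1)-D(x_2)\Vert_2\le C_{B_x}\Vert x_1-x_2\Vert_2$ for all $x_1,x_2\in B_x$. *)

(* Defs.v *)
From HB Require Import structures.
From mathcomp Require Import all_boot all_order all_algebra.
From mathcomp Require Import all_classical all_reals all_analysis.
From mathcomp Require Import zify.
Set Implicit Arguments.
Unset Strict Implicit.
Unset Printing Implicit Defensive.
Import Order.TTheory GRing.Theory Num.Theory.
Import numFieldNormedType.Exports.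
Local Open Scope classical_set_scope.
Local Open Scope ring_scope.

(* The library norm on 'rV[R]_m is the sup norm, hence a separate Euclidean
   norm. Both norms define the same topology and the same differentiability. *)
Definition norm2 (R : realType) (m : nat) (x : 'rV[R]_m) : R :=
  Num.sqrt (\sum_(i < m) x 0 i ^+ 2).

Definition locally_lipschitz (R : realType) (m : nat)
    (D : 'rV[R]_m -> 'rV[R]_m) : Prop :=
  continuous D /\
  forall x : 'rV[R]_m, exists r C : R, [/\ 0 < r, 0 <= C &
    forall x1 x2 : 'rV[R]_m, norm2 (x1 - x) < r -> norm2 (x2 - x) < r ->
      norm2 (D x1 - D x2) <= C * norm2 (x1 - x2)].

(* ['D_v f x] is a total function with a junk value where the limit does not
   exist: [gradient f] is meaningful at the points where f is differentiable. *)
Definition gradient (R : realType) (m : nat) (f : 'rV[R]_m -> R)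
    (x : 'rV[R]_m) : 'rV[R]_m :=
  \row_i 'D_(delta_mx 0 i) f x.

Definition dln_dim (N d : nat) : nat := (N.-1 * d ^ 2 + N * d + 1)%N.

(* Coordinate number k, with default value 0 for k >= m. *)
Definition coordn (R : realType) (m : nat) (x : 'rV[R]_m) (k : nat) : R :=
  if insub k is Some i then x 0 i else 0.

(* A parameter vector is the concatenation of W_1, ..., W_(N-1) (each row by
   row), W_N, b_1, ..., b_(N-1), b_N. Layers are counted from 0: [hidden_weight
   x l] and [hidden_bias x l] stand for W_(l+1) and b_(l+1) and are only used
   for l < N - 1. The default value of [coordn] is then never reached, see
   [dln_params_bij]. *)
Section DeepLinearNetwork.
Variables (R : realType) (N d : nat).
Implicit Type x : 'rV[R]_(dln_dim N d).

Definition hidden_weight x (l : nat) : 'M[R]_d :=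
  \matrix_(i < d, j < d) coordn x (l * d ^ 2 + i * d + j).

Definition out_weight x : 'rV[R]_d :=
  \row_(j < d) coordn x (N.-1 * d ^ 2 + j).

Definition hidden_bias x (l : nat) : 'cV[R]_d :=
  \col_(i < d) coordn x (N.-1 * d ^ 2 + d + l * d + i).

Definition out_bias x : R := coordn x (N.-1 * d ^ 2 + N * d).

Definition eta x (z : 'cV[R]_d) : R :=
  (out_weight x *m
     iteri N.-1 (fun l h => hidden_weight x l *m h + hidden_bias x l) z) 0 0
  + out_bias x.

(* The first standard basis vector. *)
Definition s1 : 'cV[R]_d := \col_(i < d) (i == 0%N :> nat)%:R.

Definition dln_objective x : R :=
  2^-1 * (eta x 0 + ln (1 + expR (- eta x 0)))
  + 2^-1 * ln (1 + expR (- eta x s1)).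

End DeepLinearNetwork.

Lemma coordnE (R : realType) (m : nat) (x : 'rV[R]_m) (i : 'I_m) :
  coordn x i = x 0 i.
Proof. by rewrite /coordn valK. Qed.

Lemma coordn_row (R : realType) (m : nat) (F : nat -> R) (k : nat) :
  (k < m)%N -> coordn (\row_(i < m) F i) k = F k.
Proof. by move=> km; rewrite /coordn insubT mxE. Qed.

(* The encoding identifies R^m with the space of parameters: every choice of
   the N - 1 hidden weights and biases and of W_N and b_N comes from exactly
   one vector. *)
Lemma dln_params_bij (R : realType) (N d : nat) (hN : (1 <= N)%N)
    (W : nat -> 'M[R]_d) (WN : 'rV[R]_d) (b : nat -> 'cV[R]_d) (bN : R) :
  exists! x : 'rV[R]_(dln_dim N d),
    [/\ forall l, (l < N.-1)%N -> hidden_weight x l = W l,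
        out_weight x = WN,
        forall l, (l < N.-1)%N -> hidden_bias x l = b l
      & out_bias x = bN].
Proof.
have bnd a p c q : (a < p -> c < q -> a * q + c < p * q)%N.
  move=> ap cq; apply: (@leq_trans (a.+1 * q)); last by rewrite leq_mul2r ap orbT.
  by rewrite mulSn addnC ltn_add2r.
have d2 : (d ^ 2 = d * d)%N by rewrite -mulnn.
have hNd : (N * d = d + N.-1 * d)%N by rewrite -mulSn prednK.
pose v p q (A : 'M[R]_(p, q)) i j : R :=
  if insub i is Some i' then if insub j is Some j' then A i' j' else 0 else 0.
have vE p q (A : 'M[R]_(p, q)) (i : 'I_p) (j : 'I_q) : v p q A i j = A i j.
  by rewrite /v !valK.
pose c1 := (N.-1 * d ^ 2)%N.
pose F k : R :=
  if (k < c1)%N then v d d (W (k %/ d %/ d)%N) (k %/ d %% d)%N (k %% d)%N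
  else if (k < c1 + d)%N then v 1%N d WN 0%N (k - c1)%N
  else if (k < c1 + N * d)%N then
    v d 1%N (b ((k - (c1 + d)) %/ d)%N) ((k - (c1 + d)) %% d)%N 0%N
  else bN.
exists (\row_(i < dln_dim N d) F i); split.
- have dm : dln_dim N d = (c1 + N * d + 1)%N by [].
  split.
  + move=> l ln; apply/matrixP => i j; rewrite mxE.
    have ij : (i * d + j < d * d)%N by exact: bnd.
    have lt1 : (l * d ^ 2 + i * d + j < c1)%N.
      by rewrite /c1 d2 -addnA bnd.
    rewrite coordn_row; last by rewrite dm; lia.
    have d0 : (0 < d)%N by apply: leq_ltn_trans (ltn_ord i).
    rewrite /F lt1.
    have -> : (l * d ^ 2 + i * d + j = (l * d + i) * d + j)%N.
      by rewrite mulnDl d2 mulnA.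
    rewrite divnMDl// (divn_small (ltn_ord j)) addn0.
    rewrite !modnMDl (modn_small (ltn_ord i)) (modn_small (ltn_ord j)).
    by rewrite divnMDl// (divn_small (ltn_ord i)) addn0 vE.
  + apply/rowP => j; rewrite mxE -/c1.
    have jd := ltn_ord j.
    rewrite coordn_row; last by rewrite dm; lia.
    rewrite /F ltnNge leq_addr /= ltn_add2l jd addKn.
    exact: (vE 1%N d WN 0 j).
  + move=> l ln; apply/matrixP => i j; rewrite mxE -/c1.
    have li : (l * d + i < N.-1 * d)%N by exact: bnd.
    have d0 : (0 < d)%N by apply: leq_ltn_trans (ltn_ord i).
    rewrite coordn_row; last by rewrite dm; lia.
    have f1 : (c1 + d + l * d + i < c1)%N = false by lia.
    have f2 : (c1 + d + l * d + i < c1 + d)%N = false by lia.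
    have f3 : (c1 + d + l * d + i < c1 + N * d)%N by lia.
    rewrite /F f1 f2 f3 -addnA addKn divnMDl// (divn_small (ltn_ord i)) addn0.
    rewrite modnMDl (modn_small (ltn_ord i)) ord1.
    exact: (vE d 1%N (b l) i 0).
  + rewrite /out_bias -/c1 coordn_row; last by rewrite dm; lia.
    have f1 : (c1 + N * d < c1)%N = false by lia.
    have f2 : (c1 + N * d < c1 + d)%N = false by lia.
    by rewrite /F f1 f2 ltnn.
- move=> x [xW xWN xb xbN]; apply/rowP => -[k km]; rewrite mxE.
  rewrite -(coordnE x) /=.
  have dm : (k < c1 + N * d + 1)%N by [].
  rewrite /F; case: ltnP => k1; last case: ltnP => k2; last case: ltnP => k3.
  + have d0 : (0 < d)%N by move: k1; rewrite /c1; case: (d) => //; rewrite muln0.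
    have kl : (k %/ d %/ d < N.-1)%N.
      by rewrite !ltn_divLR// -mulnA -d2.
    rewrite -(xW _ kl) (vE d d _ (Ordinal (ltn_pmod (k %/ d) d0))
      (Ordinal (ltn_pmod k d0))) mxE /=.
    congr (coordn x _); rewrite d2 mulnA -mulnDl -divn_eq.
    by rewrite -divn_eq.
  + have kd : (k - c1 < d)%N by lia.
    rewrite -xWN (vE 1%N d _ 0 (Ordinal kd)) mxE /= -/c1.
    by rewrite subnKC.
  + have dNd : (d < N * d)%N by lia.
    have d0 : (0 < d)%N by move: dNd; case: (d) => //; rewrite muln0.
    have kl : ((k - (c1 + d)) %/ d < N.-1)%N by rewrite ltn_divLR//; lia.
    rewrite -(xb _ kl) (vE d 1%N _ (Ordinal (ltn_pmod (k - (c1 + d)) d0)) 0).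
    rewrite mxE /= -/c1 -addnA -divn_eq.
    by rewrite subnKC.
  + rewrite -xbN /out_bias -/c1; congr (coordn x _).
    by clear -dm k3; lia.
Qed.

(* Main.v *)
(* The functions that are differentiable and locally Lipschitz, with locally
   Lipschitz directional derivatives, contain the constants and the coordinates
   and are closed under sums, products and composition. The objective is built
   in this way from the coordinates and the function t |-> ln (1 + exp (- t)),
   which belongs to the class because its first two derivatives are bounded
   by 1. *)
Require Import Defs.
From HB Require Import structures.
From mathcomp Require Import all_boot all_order all_algebra.
From mathcomp Require Import all_classical all_reals all_analysis.
From mathcomp Require Import ring lra.
Import Order.TTheory GRing.Theory Num.Theory.
Import numFieldNormedType.Exports.
Local Open Scope classical_set_scope.
Local Open Scope ring_scope.

(** The norm is that of the space, which is the sup norm on row vectors, and any neighbourhood is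
    allowed, so that finite intersections and preimages serve directly. Euclidean balls return in
    [loclip_locally_lipschitz]. *)
Definition loclip {R : realType} {V W : normedModType R} (f : V -> W) : Prop :=
  forall x : V, exists (C : R) (A : set V), [/\ 0 <= C, nbhs x A &
    forall y z, A y -> A z -> `|f y - f z| <= C * `|y - z|].

(** Local Lipschitz continuity of [f] itself is included because [f] is a factor in the product rule
    and the inner map in the chain rule. Fixed directions [v] suffice: the entries of a gradient are
    derivatives along basis vectors. *)
Definition c11 {R : realType} {V : normedModType R} (f : V -> R) : Prop :=
  [/\ forall x, differentiable f x, loclip f & forall v, loclip ('D_v f)].

(** * Calculus of locally Lipschitz maps *)

Section LocallyLipschitz.
Context {R : realType} {V W : normedModType R}.

Lemma lip_loclip (C : R) (f : V -> W) :
  (forall y z, `|f y - f z| <= C * `|y - z|) -> loclip f.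
Proof.
move=> fC x; exists `|C|, setT; split=> //; first exact: filterT.
by move=> y z _ _; rewrite (le_trans (fC y z))// ler_wpM2r// ler_norm.
Qed.

Lemma loclip_cst (a : W) : loclip (cst a : V -> W).
Proof. by apply: (@lip_loclip 0) => y z; rewrite subrr normr0 mul0r. Qed.

Lemma loclip_continuous (f : V -> W) : loclip f -> continuous f.
Proof.
move=> fl x; have [C [A [C0 xA fA]]] := fl x.
(* [C] may be 0, whereas [C + 1] can be divided by. *)
have C1 : 0 < C + 1 by rewrite ltr_wpDl.
apply/cvgrPdist_lt => e e0; near=> y.
have Ax := nbhs_singleton xA.
have Ay : A y by near: y.
rewrite (le_lt_trans (fA _ _ Ax Ay))//.
apply: (@le_lt_trans _ _ ((C + 1) * `|x - y|)).
  by rewrite ler_wpM2r// lerDl.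
rewrite mulrC -ltr_pdivlMr//; near: y.
by apply: (@cvgr_dist_lt _ _ _ _ _ id) => //; exact: divr_gt0.
Unshelve. all: by end_near. Qed.

Lemma loclipD (f g : V -> W) : loclip f -> loclip g -> loclip (f + g).
Proof.
move=> fl gl x; have [C [A [C0 xA fA]]] := fl x.
have [D [B [D0 xB gB]]] := gl x.
exists (C + D), (A `&` B); split; [exact: addr_ge0 | exact: filterI |].
move=> y z [Ay By] [Az Bz]; rewrite opprD addrACA mulrDl.
by rewrite (le_trans (ler_normD _ _))// lerD// ?fA ?gB.
Qed.

End LocallyLipschitz.

Lemma loclip_comp {R : realType} {U V W : normedModType R}
  (g : V -> W) (f : U -> V) :
  loclip g -> loclip f -> loclip (g \o f).
Proof.
move=> gl fl x; have [C [A [C0 xA fA]]] := fl x.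
have [D [B [D0 xB gB]]] := gl (f x).
exists (D * C), (A `&` f @^-1` B); split; first exact: mulr_ge0.
  by apply: filterI => //; exact: (loclip_continuous _ fl x _ xB).
move=> y z [Ay By] [Az Bz] /=; rewrite (le_trans (gB _ _ By Bz))// -mulrA.
by rewrite ler_wpM2l// fA.
Qed.

Lemma loclipM {R : realType} {V : normedModType R} (f g : V -> R) :
  loclip f -> loclip g -> loclip (f * g).
Proof.
move=> fl gl x; have [C [A [C0 xA fA]]] := fl x.
have [D [B [D0 xB gB]]] := gl x.
have bnd (h : V -> R) : loclip h -> \forall y \near x, `|h y| <= `|h x| + 1.
  move=> /loclip_continuous hc; have := hc x => /cvgr_norm_le.
  by apply; rewrite ltrDl.
(* The increment of the product splits as f(y)(g(y) - g(z)) + g(z)(f(y) - f(z)). By continuity the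
   factors f(y) and g(z) exceed their sizes at [x] by at most 1 on a small neighbourhood. *)
exists ((`|f x| + 1) * D + (`|g x| + 1) * C).
exists (A `&` B `&` [set y | `|f y| <= `|f x| + 1]
              `&` [set y | `|g y| <= `|g x| + 1]); split.
- by rewrite addr_ge0// mulr_ge0// addr_ge0.
- by do 2![apply: filterI; last exact: bnd]; exact: filterI.
- move=> y z [[[Ay By] fy] gy] [[[Az Bz] fz] gz].
  have -> : (f * g) y - (f * g) z = f y * (g y - g z) + g z * (f y - f z).
    rewrite !mulrBr addrA [g z * f y]mulrC subrK.
    by rewrite [g z * f z]mulrC.
  rewrite (le_trans (ler_normD _ _))// mulrDl -!mulrA !normrM.
  by apply: lerD; apply: ler_pM => //; [exact: gB | exact: fA].
Qed.

(** This is the mean value theorem on the segment between the two points. *)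
Lemma bounded_derive_lip {R : realType} (g dg : R -> R) (C : R) :
  (forall x : R, is_derive x 1 g (dg x)) -> (forall x, `|dg x| <= C) ->
  forall y z, `|g y - g z| <= C * `|y - z|.
Proof.
move=> gd dgC.
have lt a b : a <= b -> `|g b - g a| <= C * `|b - a|.
  move=> ab; have gc : {within `[a, b], continuous g}.
    by apply: derivable_within_continuous => x _; have [] := gd x.
  have [c _ ->] := MVT_segment ab (fun x _ => gd x) gc.
  by rewrite normrM ler_wpM2r.
move=> y z; have [|/ltW] := leP z y; first exact: lt.
by move=> /lt; rewrite distrC [`|y - z|]distrC.
Qed.

(** A linear map on the line is determined by its value at 1. This turns the composed differentials
    of the chain rule into a product. *)
Lemma diff_scale1 {R : realType} (g : R -> R) (x v : R) :
  differentiable g x -> 'd g x v = v * 'D_1 g x.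
Proof.
by move=> dg; rewrite -[v in LHS]mulr1 -[v * 1]/(v *: 1) linearZ/= -deriveE.
Qed.

(** * Closure properties of the class [c11] *)

Section C11.
Context {R : realType} {V : normedModType R}.

Lemma c11_cst (a : R) : c11 (cst a : V -> R).
Proof.
split; [by move=> x; exact: differentiable_cst | exact: loclip_cst |].
move=> v; rewrite (_ : 'D_v _ = cst 0); first exact: loclip_cst.
by apply/funext => x; rewrite derive_cst.
Qed.

Lemma c11D (f g : V -> R) : c11 f -> c11 g -> c11 (f + g).
Proof.
move=> [fd fl dfl] [gd gl dgl]; split.
- by move=> x; exact: differentiableD.
- exact: loclipD.
- move=> v; rewrite (_ : 'D_v _ = 'D_v f + 'D_v g); first exact: loclipD.
  by apply/funext => x; rewrite deriveD//; exact: diff_derivable.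
Qed.

Lemma c11M (f g : V -> R) : c11 f -> c11 g -> c11 (f * g).
Proof.
move=> [fd fl dfl] [gd gl dgl]; split.
- by move=> x; exact: differentiableM.
- exact: loclipM.
- move=> v; rewrite (_ : 'D_v _ = f * 'D_v g + g * 'D_v f).
    by apply: loclipD; exact: loclipM.
  by apply/funext => x; rewrite deriveM//; exact: diff_derivable.
Qed.

Lemma c11_comp (g : R -> R) (f : V -> R) : c11 g -> c11 f -> c11 (g \o f).
Proof.
move=> [gd gl dgl] [fd fl dfl]; split.
- by move=> x; exact: differentiable_comp.
- exact: loclip_comp.
- move=> v; rewrite (_ : 'D_v _ = 'D_v f * ('D_1 g \o f)).
    by apply: loclipM => //; exact: loclip_comp.
  apply/funext => x; rewrite deriveE; last exact: differentiable_comp.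
  by rewrite diff_comp//= diff_scale1// -deriveE.
Qed.

Lemma c11_sum (n : nat) (F : 'I_n -> V -> R) :
  (forall i, c11 (F i)) -> c11 (fun x => \sum_(i < n) F i x).
Proof.
move=> Fc; rewrite (_ : (fun x => _) = \sum_(i < n) F i).
  by elim/big_ind : _ => // *; [exact: c11_cst | exact: c11D].
by apply/funext => x; rewrite fct_sumE.
Qed.

End C11.

(** * Building blocks: coordinates and the softplus function *)

Lemma coord_le_norm {R : realType} {m : nat} (x : 'rV[R]_m) (i : 'I_m) :
  `|x 0 i| <= `|x|.
Proof.
by rewrite [leRHS]/Num.norm/= mx_normrE; apply/bigmax_geP; right; exists (0, i).
Qed.

Lemma c11_coordn {R : realType} (m k : nat) :
  c11 (fun x : 'rV[R]_m => coordn x k).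
Proof.
rewrite /coordn; case: insubP => [i _ _|_]; last exact: c11_cst.
split.
- by move=> x; exact: differentiable_coord.
- apply: (@lip_loclip _ _ _ 1) => y z.
  by rewrite mul1r; have := coord_le_norm (y - z) i; rewrite !mxE.
- move=> v; rewrite (_ : 'D_v _ = cst (v 0 i)); first exact: loclip_cst.
  (* By linearity the difference quotient equals [v 0 i] for every nonzero [h]. *)
  apply/funext => x; apply: cvg_lim => //; apply: cvg_near_cst.
  near=> h; rewrite /= !mxE addrK -[LHS]/(_ * _) mulrA mulVf ?mul1r//.
  by near: h; exact: nbhs_dnbhs_neq.
Unshelve. all: by end_near. Qed.

Lemma c11_softplus {R : realType} : c11 (fun t : R => ln (1 + expR (- t))).
Proof.
pose u (t : R) := 1 + expR (- t).
have u0 t : 0 < u t by rewrite addr_gt0// expR_gt0.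
have du (t : R) : is_derive t 1 u (- expR (- t)).
  apply: (@is_derive_eq _ _ _ _ _ _ _ (0 + expR (- t) * -1)).
  by rewrite add0r mulrN1.
(* Since u' = 1 - u, the derivative u'/u of ln u is 1/u - 1. In this form it visibly lies in [-1, 0]
   and is easy to differentiate again. *)
pose ds (t : R) := (u t)^-1 - 1.
have ln_u (t : R) : is_derive t 1 (fun t => ln (u t)) (ds t).
  apply: (@is_derive_eq _ _ _ _ _ _ _ ((u t)^-1 * - expR (- t))).
    by apply: is_derive1_comp; exact: is_derive1_ln.
  by rewrite /ds; have := u0 t; rewrite /u => ?; field; rewrite gt_eqF.
have ds' (t : R) : is_derive t 1 ds (expR (- t) / u t ^+ 2).
  apply: (@is_derive_eq _ _ _ _ _ _ _ (- (u t) ^- 2 *: (- expR (- t)) - 0)).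
    apply: (@is_deriveB _ _ _ (fun t => (u t)^-1) (cst 1)).
    by apply: is_deriveV => //; rewrite gt_eqF.
  by rewrite subr0 scaleNr scalerN opprK mulrC.
have iu01 t : 0 <= (u t)^-1 <= 1.
  by rewrite invr_ge0 ltW//= invf_le1// lerDl expR_ge0.
have ds_le1 t : `|ds t| <= 1.
  by rewrite ler_norml /ds; have /andP[? ?] := iu01 t; apply/andP; split; lra.
have ds'_le1 t : `|expR (- t) / u t ^+ 2| <= 1.
  rewrite ger0_norm; last by rewrite divr_ge0 ?expR_ge0// exprn_ge0// ltW.
  rewrite ler_pdivrMr ?exprn_gt0// mul1r.
  (* With e = exp(-t) >= 0, the claim is e <= (1 + e)^2. *)
  by have := expR_ge0 (- t); rewrite /u => ?; nra.
have dlnu (t : R) : differentiable (fun t => ln (u t)) t.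
  by apply/derivable1_diffP; have [] := ln_u t.
split=> //.
- exact/lip_loclip/bounded_derive_lip.
- move=> v; rewrite (_ : 'D_v _ = cst v * ds).
    apply: loclipM; first exact: loclip_cst.
    exact/lip_loclip/bounded_derive_lip.
  apply/funext => t.
  by rewrite deriveE// diff_scale1// (@derive_val _ _ _ _ _ _ _ (ln_u t)).
Qed.

(** * Passage between the sup norm and the Euclidean norm *)

Section Norm2.
Context {R : realType} {m : nat}.
Implicit Type x : 'rV[R]_m.

Lemma norm_le_norm2 x : `|x| <= norm2 x.
Proof.
rewrite [leLHS]/Num.norm/= mx_normrE; apply/bigmax_leP.
split=> [|[i j] _ /=]; first exact: sqrtr_ge0.
rewrite ord1 -sqrtr_sqr ler_wsqrtr// (bigD1 j)//= lerDl.
by apply: sumr_ge0 => k _; exact: sqr_ge0.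
Qed.

Lemma norm2_le_norm x : norm2 x <= Num.sqrt m%:R * `|x|.
Proof.
rewrite -[`|x|]ger0_norm// -sqrtr_sqr -sqrtrM// ler_wsqrtr//.
rewrite mulr_natl -[m in _ *+ m]card_ord -sumr_const ler_sum// => i _.
by rewrite -real_normK ?num_real// lerXn2r ?nnegrE// coord_le_norm.
Qed.

Lemma loclip_locally_lipschitz (D : 'rV[R]_m -> 'rV[R]_m) :
  loclip D -> locally_lipschitz D.
Proof.
move=> Dl; split; first exact: loclip_continuous.
move=> x; have [C [A [C0 /nbhs_ballP[r r0 rA] DA]]] := Dl x.
have xA y : norm2 (y - x) < r -> A y.
  move=> yx; apply: rA; rewrite -ball_normE/= distrC.
  exact: le_lt_trans (norm_le_norm2 _) yx.
(* A Euclidean ball lies in the sup-norm ball of the same radius, so [r] is kept; bounding the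
   Euclidean norm of the values by their sup norm costs the factor sqrt(m). *)
exists r, (Num.sqrt m%:R * C); split=> // [|x1 x2 /xA Ax1 /xA Ax2].
  by rewrite mulr_ge0// sqrtr_ge0.
rewrite (le_trans (norm2_le_norm _))// -mulrA ler_wpM2l ?sqrtr_ge0//.
by rewrite (le_trans (DA _ _ Ax1 Ax2))// ler_wpM2l// norm_le_norm2.
Qed.

Lemma loclip_row {V : normedModType R} (F : 'I_m -> V -> R) :
  (forall i, loclip (F i)) -> loclip (fun y => \row_i F i y).
Proof.
move=> Fl y0; have /choice[C CP] := fun i => Fl i y0.
have /choice[A AP] := CP.
(* The sum dominates each [C i] since all are nonnegative; the intersection of the [A i] is a
   neighbourhood because the index set is finite. *)
exists (\sum_i C i), [set y | forall i, A i y]; split.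
- by apply: sumr_ge0 => i _; have [] := AP i.
- by apply: filter_forall => i; have [] := AP i.
- move=> y z Ay Az; rewrite [leLHS]/Num.norm/= mx_normrE; apply/bigmax_leP.
  have C0 i : 0 <= C i by have [] := AP i.
  split=> [|[i j] _ /=]; first by rewrite mulr_ge0// sumr_ge0.
  rewrite !mxE; have [_ _ FA] := AP j.
  rewrite (le_trans (FA _ _ (Ay j) (Az j)))// ler_wpM2r//.
  by rewrite (bigD1 j)//= lerDl sumr_ge0.
Qed.

End Norm2.

(** * The network and its objective *)

Lemma c11_eta {R : realType} (N d : nat) (z : 'cV[R]_d) :
  c11 (fun x : 'rV[R]_(dln_dim N d) => Defs.eta x z).
Proof.
(* The induction is on the number of layers applied, entry by entry because [c11] concerns
   real-valued functions. It runs over every [n], as [c11_coordn] holds at every index, in range or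
   not. *)
have layers n i : c11 (fun x : 'rV[R]_(dln_dim N d) =>
    iteri n (fun l h => hidden_weight x l *m h + hidden_bias x l) z i 0).
  elim: n i => [|n IHn] i /=; first exact: c11_cst.
  rewrite (_ : (fun x => _) = (fun x : 'rV[R]_(dln_dim N d) =>
      \sum_(j < d) coordn x (n * d ^ 2 + i * d + j) *
        iteri n (fun l h => hidden_weight x l *m h + hidden_bias x l) z j 0)
      + (fun x => coordn x (N.-1 * d ^ 2 + d + n * d + i))).
    apply: c11D; last exact: c11_coordn.
    by apply: c11_sum => j; apply: c11M; [exact: c11_coordn | exact: IHn].
  by apply/funext => x; rewrite !mxE; congr (_ + _);
    apply: eq_bigr => j _; rewrite mxE.
rewrite /Defs.eta; apply: c11D; last exact: c11_coordn.
under eq_fun do rewrite mxE.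
apply: c11_sum => j; apply: c11M; last exact: layers.
under eq_fun do rewrite mxE.
exact: c11_coordn.
Qed.

Lemma c11_dln_objective {R : realType} (N d : nat) :
  c11 (@dln_objective R N d).
Proof.
have softplus_eta z : c11 (fun x : 'rV[R]_(dln_dim N d) =>
    ln (1 + expR (- Defs.eta x z))).
  exact: (c11_comp _ _ c11_softplus (c11_eta _ _ z)).
apply: c11D; apply: c11M => //; do ?exact: c11_cst.
by apply: c11D => //; exact: c11_eta.
Qed.

Theorem proposition8 (R : realType) (N d : nat)
    (hN : (1 <= N)%N) (hd : (1 <= d)%N) :
  (forall x : 'rV[R]_(dln_dim N d), differentiable (@dln_objective R N d) x) /\
  locally_lipschitz (gradient (@dln_objective R N d)).
Proof.
(* [dfl] at the basis vectors gives the entries of the gradient, which [loclip_row] assembles. *)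
have [fd _ dfl] := @c11_dln_objective R N d.
by split=> //; apply: loclip_locally_lipschitz; exact: loclip_row.
Qed.
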